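(* Let $G$ be a Lie group acting effectively by isometries on a connected Riemannian manifold $(M,g)$, with Lie algebra $\mathfrak{g}$ identified with a Lie algebra of Killing vector fields on $(M,g)$. Let $X\in\mathfrak{g}$ be a Killing vector field of constant length on $(M,g)$. Suppose that $\mathfrak{g}=\mathfrak{g}_1\oplus\cdots\oplus\mathfrak{g}_l$, $l\geq 2$, is a direct Lie algebra sum. Then for every $i=1,\dots,l$ there is an ideal $\mathfrak{u}_i$ in $\mathfrak{g}_i$ such that $[X,\mathfrak{g}_i]\subset\mathfrak{u}_i$ for every $i$, and $g(\mathfrak{u}_i,\mathfrak{u}_j)=0$ on $M$ for every $i\neq j$.
   Context: Each $U\in\mathfrak{g}$ is identified with the Killing vector field $\widetilde U$ on $M$ given by $\widetilde{U}(x)=\frac{d}{dt}\exp(tU)(x)\big|_{t=0}$. The map $U\mapsto\widetilde U$ is linear and injective, and $[\widetilde U,\widetilde V]=-\widetilde{[U,V]_{\mathfrak g}}$, where $[\cdot,\cdot]_{\mathfrak g}$ is the Lie bracket of $\mathfrak g$ and $[\cdot,\cdot]$ is the Lie bracket of vector fields; under the identification, $[\cdot,\cdot]$ denotes the bracket of vector fields. For $U,V\in\mathfrak g$, $g(U,V)$ denotes the function $x\mapsto g_x(U(x),V(x))$ on $M$; for subspaces $\mathfrak u,\mathfrak v\subset\mathfrak g$, ''$g(\mathfrak u,\mathfrak v)=0$ on $M$'' means $g(U,V)\equiv 0$ on $M$ for all $U\in\mathfrak u$, $V\in\mathfrak v$. $X$ has constant length if the function $g(X,X)$ is constant on $M$.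 *)

(* Defs.v *)
From HB Require Import structures.
From mathcomp Require Import all_boot all_order all_algebra.
From mathcomp Require Import all_classical all_reals all_analysis.

Set Implicit Arguments.
Unset Strict Implicit.
Unset Printing Implicit Defensive.

Import Order.TTheory GRing.Theory Num.Theory.
Import numFieldNormedType.Exports.

Local Open Scope classical_set_scope.
Local Open Scope ring_scope.

(* Meant for [A] open and [V] finite-dimensional, where this is the usual
   notion: [f] is of class C^(k+1) iff it is differentiable and all its
   directional derivatives are of class C^k. *)
Fixpoint Ck_on (R : realType) (V W : normedModType R) (k : nat) (A : set V)
    (f : V -> W) : Prop :=
  match k with
  | 0 => {within A, continuous f}
  | k'.+1 => (forall x, A x -> differentiable f x) /\
             (forall v, Ck_on k' A (fun x => 'D_v f x))
  end.

Definition smooth_on (R : realType) (V W : normedModType R) (A : set V)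
    (f : V -> W) : Prop :=
  forall k, Ck_on k A f.

(* A homeomorphism between an open subset [chart_dom] of [M] and an open subset
   [chart_cod] of R^n; [chart_map] and [chart_inv] are only relevant there. *)
Record chart (R : realType) (n : nat) (M : topologicalType) := Chart {
  chart_dom : set M;
  chart_cod : set 'rV[R]_n;
  chart_map :> M -> 'rV[R]_n;
  chart_inv : 'rV[R]_n -> M;
  chart_dom_open : open chart_dom;
  chart_cod_open : open chart_cod;
  chart_map_cod : forall x, chart_dom x -> chart_cod (chart_map x);
  chart_inv_dom : forall z, chart_cod z -> chart_dom (chart_inv z);
  chart_mapK : forall x, chart_dom x -> chart_inv (chart_map x) = x;
  chart_invK : forall z, chart_cod z -> chart_map (chart_inv z) = z;
  chart_map_continuous : {within chart_dom, continuous chart_map};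
  chart_inv_continuous : {within chart_cod, continuous chart_inv}
}.

(* Smooth n-dimensional manifolds (Hausdorff, second countable).  The atlas need
   not be maximal.  Besides the atlas, one chart [chart_at x] around each point
   [x] is singled out (no compatibility in [x] is required): it serves to
   represent tangent vectors, see [tangent_map]. *)
HB.mixin Record isManifold (R : realType) (n : nat) M of Topological M := {
  atlas : set (chart R n M);
  chart_at : M -> chart R n M;
  chart_at_atlas : forall x, atlas (chart_at x);
  chart_at_dom : forall x, chart_dom (chart_at x) x;
  atlas_smooth : forall c c', atlas c -> atlas c' ->
    smooth_on (chart_cod c `&` chart_inv c @^-1` chart_dom c')
              (c' \o chart_inv c);
  manifold_hausdorff : hausdorff_space M;
  manifold_second_countable : @second_countable M
}.

#[short(type="manifoldType")]
HB.structure Definition Manifold (R : realType) (n : nat) :=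
  {M of isManifold R n M & Topological M}.

Definition smooth_map (R : realType) (m n : nat) (M : manifoldType R m)
    (N : manifoldType R n) (f : M -> N) : Prop :=
  continuous f /\
  forall (c : chart R m M) (d : chart R n N), atlas c -> atlas d ->
    smooth_on (chart_cod c `&` chart_inv c @^-1` (f @^-1` chart_dom d))
              (d \o f \o chart_inv c).

(* Smoothness of a map defined on the product manifold [M * N], with respect to
   the product charts, which take values in R^m x R^n. *)
Definition smooth_map2 (R : realType) (m n p : nat) (M : manifoldType R m)
    (N : manifoldType R n) (P : manifoldType R p) (f : M -> N -> P) : Prop :=
  continuous (fun z : M * N => f z.1 z.2) /\
  forall (c : chart R m M) (d : chart R n N) (e : chart R p P),
    atlas c -> atlas d -> atlas e ->
    smooth_on
      [set z : 'rV[R]_m * 'rV[R]_n |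
         [/\ chart_cod c z.1, chart_cod d z.2 &
             chart_dom e (f (chart_inv c z.1) (chart_inv d z.2))]]
      (fun z => e (f (chart_inv c z.1) (chart_inv d z.2))).

Definition smooth_curve (R : realType) (n : nat) (M : manifoldType R n)
    (gamma : R -> M) : Prop :=
  continuous gamma /\
  forall c : chart R n M, atlas c ->
    smooth_on (gamma @^-1` chart_dom c : set R^o)
              (c \o gamma : R^o -> 'rV[R]_n).

(* The tangent space at [x] is modelled on ['rV[R]_n]: a row vector stands for
   the tangent vector at [x] having these coordinates in the chart [chart_at x].
   Hence vector fields on [M] are functions [M -> 'rV[R]_n], with their pointwise
   vector space structure, and [tangent_map f x] is the differential
   T_x M -> T_(f x) N of [f]. *)
Definition tangent_map (R : realType) (m n : nat) (M : manifoldType R m)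
    (N : manifoldType R n) (f : M -> N) (x : M) (v : 'rV[R]_m) : 'rV[R]_n :=
  'd (chart_at (f x) \o f \o chart_inv (chart_at x)) (chart_at x x) v.

(* gamma'(t), a tangent vector at [gamma t] *)
Definition velocity (R : realType) (n : nat) (M : manifoldType R n)
    (gamma : R -> M) (t : R) : 'rV[R]_n :=
  derive1 (chart_at (gamma t) \o gamma) t.

(* The coordinate expression of the vector field [U] in the chart [c], as an
   R^n-valued function on [chart_cod c]. *)
Definition field_in (R : realType) (n : nat) (M : manifoldType R n)
    (c : chart R n M) (U : M -> 'rV[R]_n) (z : 'rV[R]_n) : 'rV[R]_n :=
  let y := chart_inv c z in
  'd (c \o chart_inv (chart_at y)) (chart_at y y) (U y).

Definition smooth_field (R : realType) (n : nat) (M : manifoldType R n)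
    (U : M -> 'rV[R]_n) : Prop :=
  forall c : chart R n M, atlas c -> smooth_on (chart_cod c) (field_in c U).

(* The bracket [U, V] of vector fields, by its coordinate expression
   dV(U) - dU(V) in the chart [chart_at x]; at [x] itself, the coordinates of
   [U] and [V] in this chart are [U x] and [V x]. *)
Definition lie_bracket (R : realType) (n : nat) (M : manifoldType R n)
    (U V : M -> 'rV[R]_n) (x : M) : 'rV[R]_n :=
  let c := chart_at x in
  'd (field_in c V) (c x) (U x) - 'd (field_in c U) (c x) (V x).

Record riemannian_metric (R : realType) (n : nat) (M : manifoldType R n)
    (g : M -> 'rV[R]_n -> 'rV[R]_n -> R) : Prop := {
  metric_linear : forall x u, scalar (g x u);
  metric_sym : forall x u v, g x u v = g x v u;
  metric_pos : forall x u, u != 0 -> 0 < g x u u;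
  metric_smooth : forall (c : chart R n M) (v w : 'rV[R]_n), atlas c ->
    smooth_on (chart_cod c)
      (fun z : 'rV[R]_n =>
         let y := chart_inv c z in
         let toT := 'd (chart_at y \o chart_inv c) z in
         g y (toT v) (toT w) : R^o)
}.

HB.mixin Record isLieGroup (R : realType) (n : nat) G
    of Manifold R n G & Group G := {
  mulg_smooth : smooth_map2 (fun a b : G => (a * b)%g);
  invg_smooth : smooth_map (fun a : G => (a^-1)%g)
}.

#[short(type="lieGroupType")]
HB.structure Definition LieGroup (R : realType) (n : nat) :=
  {G of isLieGroup R n G & Manifold R n G & Group G}.

Definition left_invariant (R : realType) (m : nat) (G : lieGroupType R m)
    (U : G -> 'rV[R]_m) : Prop :=
  smooth_field U /\
  forall a b : G, U (a * b)%g = tangent_map (fun y : G => (a * y)%g) b (U b).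

Definition one_parameter_subgroup (R : realType) (m : nat)
    (G : lieGroupType R m) (phi : R -> G) : Prop :=
  smooth_curve phi /\ forall s t, phi (s + t) = (phi s * phi t)%g.

(* [lie_exp U t] is exp(t U), that is, the one-parameter subgroup with initial
   velocity [U 1]; for a left-invariant [U] it exists and is unique, so that the
   default value is never used. *)
Definition lie_exp (R : realType) (m : nat) (G : lieGroupType R m)
    (U : G -> 'rV[R]_m) : R -> G :=
  xget (fun=> 1%g)
    [set phi | one_parameter_subgroup phi /\ velocity phi 0 = U 1%g].

Record smooth_action (R : realType) (m n : nat) (G : lieGroupType R m)
    (M : manifoldType R n) (act : G -> M -> M) : Prop := {
  action_one : forall x, act 1%g x = x;
  action_mul : forall a b x, act (a * b)%g x = act a (act b x);
  action_smooth : smooth_map2 act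
}.

Definition effective (R : realType) (m n : nat) (G : lieGroupType R m)
    (M : manifoldType R n) (act : G -> M -> M) : Prop :=
  forall a : G, (forall x, act a x = x) -> a = 1%g.

Definition by_isometries (R : realType) (m n : nat) (G : lieGroupType R m)
    (M : manifoldType R n) (g : M -> 'rV[R]_n -> 'rV[R]_n -> R)
    (act : G -> M -> M) : Prop :=
  forall (a : G) (x : M) (u v : 'rV[R]_n),
    g (act a x) (tangent_map (act a) x u) (tangent_map (act a) x v) = g x u v.

(* The vector field x |-> d/dt exp(t U)(x) at t = 0 on [M]. *)
Definition killing_field (R : realType) (m n : nat) (G : lieGroupType R m)
    (M : manifoldType R n) (act : G -> M -> M) (U : G -> 'rV[R]_m) (x : M) :
    'rV[R]_n :=
  velocity (fun t => act (lie_exp U t) x) 0.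

(* The Lie algebra of [G], i.e., the left-invariant vector fields on [G],
   identified with a Lie algebra of vector fields on [M] through
   [killing_field]; the bracket is [lie_bracket] on [M]. *)
Definition killing_algebra (R : realType) (m n : nat) (G : lieGroupType R m)
    (M : manifoldType R n) (act : G -> M -> M) : set (M -> 'rV[R]_n) :=
  [set killing_field act U | U in @left_invariant R m G].

Definition subspace_of (R : realType) (n : nat) (M : manifoldType R n)
    (h : set (M -> 'rV[R]_n)) : Prop :=
  h 0 /\ forall (a : R) U V, h U -> h V -> h (a *: U + V).

Record lie_ideal (R : realType) (n : nat) (M : manifoldType R n)
    (u h : set (M -> 'rV[R]_n)) : Prop := {
  ideal_subspace : subspace_of u;
  ideal_sub : u `<=` h;
  ideal_bracket : forall U V, h U -> u V -> u (lie_bracket U V)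
}.

(* [k] is the direct sum of its Lie subalgebras [h i], which commute pairwise. *)
Record direct_lie_sum (R : realType) (n : nat) (M : manifoldType R n) (l : nat)
    (k : set (M -> 'rV[R]_n)) (h : 'I_l -> set (M -> 'rV[R]_n)) : Prop := {
  summand_subspace : forall i, subspace_of (h i);
  summand_bracket : forall i U V, h i U -> h i V -> h i (lie_bracket U V);
  summand_commute : forall i j U V, i != j -> h i U -> h j V ->
    lie_bracket U V = 0;
  sum_eq : k = [set \sum_i W i | W in [set W | forall i, h i (W i)]];
  sum_direct : forall W : 'I_l -> (M -> 'rV[R]_n), (forall i, h i (W i)) ->
    \sum_i W i = 0 -> forall i, W i = 0
}.

(* Main.v *)
From HB Require Import structures.
Require Import Defs.
From mathcomp Require Import all_boot all_order all_algebra.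
From mathcomp Require Import all_classical all_reals all_analysis.

Set Implicit Arguments.
Unset Strict Implicit.
Unset Printing Implicit Defensive.

Import Order.TTheory GRing.Theory Num.Theory.
Import numFieldNormedType.Exports.

Local Open Scope classical_set_scope.
Local Open Scope ring_scope.

(** If W is a Killing field and g(U, V) is constant, then differentiating along
    the flow of W gives g([W, U], V) + g(U, [W, V]) = 0.  For U = V = X this
    shows that g([Y, X], X) = 0 for all Y in the Lie algebra.  For Y in g_i, Z
    in g_j and i <> j, applying the rule again to this identity with W = Z gives
    g([X, Y], [X, Z]) = 0, because [Z, [Y, X]] = 0.  Finally, the elements of
    g_i orthogonal on M to a given subset of g_j form an ideal of g_i, again by
    the rule since [g_i, g_j] = 0; so the smallest ideals u_i of g_i containing
    [X, g_i] are pairwise orthogonal.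

    In a chart, let F(q, z) be the local expression of the action, p(t) the
    coordinates of the one-parameter subgroup of W and w its field.  Comparing
    the derivatives at t = 0 of g along the flow, applied to the vectors
    D_z F(p(t), z) u (constant by isometry) and to the values of the fields U, V
    (constant by hypothesis), gives the rule; the symmetry of the second
    derivatives of F turns the derivative of D_z F(p(t), z) u into Dw(z) u. *)

(** * Symmetry of second derivatives *)

(** The first-order expansion at [x] involves only values near [x], and it determines the
    differential. Identities such as [chart_mapK] hold on chart domains, hence only near a point. *)
Lemma near_eq_is_diff (R : realType) (V W : normedModType R) (f g : V -> W)
    (x : V) (df : V -> W) :
  (\near x, f x = g x) -> is_diff x f df -> is_diff x g df.
Proof.
move=> fg [dfx <-].
have fgx : f x = g x by exact: nbhs_singleton fg.
have /diff_locallyP[cd /eqaddoP Ef] := dfx.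
have Eg : g \o shift x = cst (g x) + 'd f x +o_ 0 id.
  apply/eqaddoP => e e0; near=> h.
  have -> : (g \o shift x - (cst (g x) + 'd f x)) h =
            (f \o shift x - (cst (f x) + 'd f x)) h.
    rewrite /= !fctE /= -fgx; congr (_ - _); apply/esym.
    by near: h; move: fg; rewrite (near_shift 0) /= subr0.
  by near: h; exact: Ef.
have Ed : 'd g x = 'd f x :> (V -> W) by exact: diff_unique.
split; last exact: Ed.
by apply/diff_locallyP; rewrite Ed; split; [exact: cd|exact: Eg].
Unshelve. all: by end_near. Qed.

Lemma is_diff_comp_near (R : realType) (U V W : normedModType R)
    (f : U -> V) (g : V -> W) (k : U -> W) (x : U) (df : U -> V) (dg : V -> W) :
  is_diff x f df -> is_diff (f x) g dg -> (\near x, g (f x) = k x) ->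
  is_diff x k (dg \o df).
Proof.
by move=> hf hg e; apply: near_eq_is_diff e (is_diff_comp hf hg).
Qed.

(* Mean value theorem, first in the direction [v], then in the direction [w]. *)
Lemma second_difference (R : realType) (V : normedModType R) (f : V -> R)
    (x v w : V) (s : R) :
  0 < s ->
  (forall a b, 0 <= a <= s -> 0 <= b <= s ->
     differentiable f (x + a *: v + b *: w) /\
     differentiable ('D_v f) (x + a *: v + b *: w)) ->
  exists a b, [/\ 0 <= a <= s, 0 <= b <= s &
    f (x + s *: v + s *: w) - f (x + s *: v) - f (x + s *: w) + f x =
    'D_w ('D_v f) (x + a *: v + b *: w) * (s * s)].
Proof.
move=> s0 df.
have line (h : V -> R) (y u : V) (t : R) : differentiable h (y + t *: u) ->
    is_derive t 1 (fun t => h (y + t *: u)) ('D_u h (y + t *: u)).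
  move=> dh; have dl : is_diff t (fun t => y + t *: u) (fun t => t *: u).
    by apply: is_diff_eq; rewrite add0r.
  have dc : is_diff t (h \o (fun t => y + t *: u))
      ('d h (y + t *: u) \o (fun t => t *: u)).
    by apply: is_diff_comp; exact: differentiableP.
  apply: DeriveDef; first by apply/diff_derivable; case: dc.
  by rewrite deriveE; [rewrite (diff_val) /= scale1r deriveE|case: dc].
have lineP (h : V -> R) (y u : V) :
    (forall t, 0 <= t <= s -> differentiable h (y + t *: u)) ->
    exists2 t, 0 <= t <= s & h (y + s *: u) - h y = 'D_u h (y + t *: u) * s.
  move=> dh.
  have dI t : 0 <= t <= s -> is_derive t 1 (fun t => h (y + t *: u))
      ('D_u h (y + t *: u)) by move=> ts; exact/line/dh.
  have [t|t|t tI] := @MVT _ (fun t => h (y + t *: u))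
      (fun t => 'D_u h (y + t *: u)) 0 s s0.
  - by rewrite in_itv /= => /andP[t0 ts]; apply: dI; rewrite !ltW.
  - apply: derivable_within_continuous => {}t; rewrite in_itv /= => ts.
    by have [] := dI _ ts.
  - rewrite scale0r addr0 subr0 => ->; exists t => //.
    by move: tI; rewrite in_itv /= => /andP[? ?]; rewrite !ltW.
have s0s : 0 <= s <= s by rewrite (ltW s0) lexx.
have z0s : (0 : R) <= 0 <= s by rewrite lexx (ltW s0).
have dsh y : differentiable f (y + s *: w) ->
    is_diff y (fun y => f (y + s *: w)) ('d f (y + s *: w)).
  move=> dy; have da : is_diff y (fun y => y + s *: w) id.
    by apply: is_diff_eq; rewrite addr0.
  exact: (is_diff_comp da (differentiableP dy)).
have d2 y : differentiable f (y + s *: w) -> differentiable f y ->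
    is_diff y (fun y => f (y + s *: w) - f y)
      (fun u => 'd f (y + s *: w) u - 'd f y u).
  move=> dy1 dy; have := dsh _ dy1; have := differentiableP dy => ? ?.
  by apply: is_diff_eq.
have dxv t : 0 <= t <= s -> differentiable f (x + t *: v).
  by move=> ts; have [] := df t 0 ts z0s; rewrite scale0r addr0.
(* The second difference is the increment of [fun y => f (y + s *: w) - f y] along [s *: v]. The
   second mean value, along [w], starts from the point [x + a *: v] found here. *)
have [a as_ Ea] := lineP (fun y => f (y + s *: w) - f y) x v (fun t ts =>
  @ex_diff _ _ _ _ _ _ _ (d2 _ (df t s ts s0s).1 (dxv t ts))).
have [b bs Eb] := lineP ('D_v f) (x + a *: v) w (fun t ts => (df a t as_ ts).2).
exists a, b; split => //.
have [da1 _] := df a s as_ s0s.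
have d2a := d2 _ da1 (dxv _ as_).
have Dva : 'D_v (fun y => f (y + s *: w) - f y) (x + a *: v) =
    'D_v f (x + a *: v + s *: w) - 'D_v f (x + a *: v).
  by rewrite !deriveE; [rewrite diff_val|exact: dxv|exact: da1|case: d2a].
by rewrite mulrA -Eb -Dva -Ea opprB addrA addrAC -addrA.
Qed.

(** Schwarz's theorem. The second difference over a small parallelogram is symmetric in [v] and [w],
    so [second_difference] equates the two mixed derivatives at two points near [x]; by continuity
    their values at [x] then differ by at most [e]. *)
Lemma derive_comm (R : realType) (V : normedModType R) (f : V -> R)
    (x v w : V) :
  (\near x, differentiable f x) ->
  (\near x, differentiable ('D_v f) x) ->
  (\near x, differentiable ('D_w f) x) ->
  {for x, continuous ('D_w ('D_v f))} -> {for x, continuous ('D_v ('D_w f))} ->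
  'D_w ('D_v f) x = 'D_v ('D_w f) x.
Proof.
move=> nf nv nw cwv cvw.
apply/eqP; rewrite -subr_eq0 -normr_le0; apply/ler_addgt0Pl => e e0.
rewrite addr0.
have e20 : 0 < e / 2 by rewrite divr_gt0.
have /nbhs_ballP[d /= d0 dP] : \forall z \near x, [/\ differentiable f z,
    differentiable ('D_v f) z, differentiable ('D_w f) z,
    `|'D_w ('D_v f) x - 'D_w ('D_v f) z| < e / 2 &
    `|'D_v ('D_w f) x - 'D_v ('D_w f) z| < e / 2].
  move/cvgrPdist_lt: cwv => /(_ _ e20) n1.
  move/cvgrPdist_lt: cvw => /(_ _ e20) n2.
  apply: (filterS _ (filterI nf (filterI nv (filterI nw (filterI n1 n2))))).
  move=> z [h1 [h2 [h3 [h4 h5]]]]; exact: And5 h1 h2 h3 h4 h5.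
(* The summand 1 keeps [C] positive even if [v] and [w] vanish. The side [s] satisfies
   [s * C = d / 2], which keeps the parallelogram inside the ball of radius [d]. *)
pose C := `|v| + `|w| + 1.
have C0 : 0 < C by rewrite /C ltr_wpDl ?addr_ge0.
pose s := d / C / 2.
have s0 : 0 < s by rewrite /s !divr_gt0.
have sB a b : 0 <= a <= s -> 0 <= b <= s -> ball x d (x + a *: v + b *: w).
  move=> /andP[a0 as_] /andP[b0 bs].
  rewrite -ball_normE /= -addrA opprD addrA subrr sub0r normrN.
  apply: le_lt_trans (ler_normD _ _) _; rewrite !normrZ !ger0_norm //.
  apply: (@le_lt_trans _ _ (s * C)).
    rewrite /C !mulrDr -[leLHS]addr0 lerD ?mulr1 ?(ltW s0) //.
    by rewrite lerD // ler_wpM2r.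
  have -> : s * C = d / 2 by rewrite /s mulrAC divfK ?gt_eqF.
  by rewrite ltr_pdivrMr // ltr_pMr // ltr1n.
have sB' a b : 0 <= a <= s -> 0 <= b <= s -> ball x d (x + a *: w + b *: v).
  by move=> ? ?; rewrite addrAC; exact: sB.
have [a [b [aI bI E1]]] := second_difference s0 (fun a b aI bI =>
  let: And5 h1 h2 _ _ _ := dP _ (sB a b aI bI) in conj h1 h2).
have [a' [b' [aI' bI' E2]]] := second_difference s0 (fun a b aI bI =>
  let: And5 h1 _ h3 _ _ := dP _ (sB' a b aI bI) in conj h1 h3).
have ss0 : s * s != 0 by rewrite mulf_neq0 ?gt_eqF.
have E3 : f (x + s *: v + s *: w) - f (x + s *: v) - f (x + s *: w) + f x =
          f (x + s *: w + s *: v) - f (x + s *: w) - f (x + s *: v) + f x.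
  by rewrite (addrAC x); congr (_ + _); exact: addrAC.
have E := mulIf ss0 (etrans (esym E1) (etrans E3 E2)).
have [_ _ _ H1 _] := dP _ (sB _ _ aI bI).
have [_ _ _ _ H2] := dP _ (sB' _ _ aI' bI').
have dist (p q r : R) : `|p - r| < e / 2 -> `|q - r| < e / 2 -> `|p - q| <= e.
  move=> h1 h2; apply: le_trans (ler_distD r _ _) _.
  by rewrite [leRHS]splitr (distrC r); exact: ltW (ltrD h1 h2).
by rewrite E in H1; exact: dist H1 H2.
Qed.

Lemma near_eq_differentiable (R : realType) (V W : normedModType R)
    (f g : V -> W) (x : V) :
  (\near x, f x = g x) -> differentiable f x -> differentiable g x.
Proof.
by move=> fg df; have [] := near_eq_is_diff fg (differentiableP df).
Qed.

Lemma smooth_on_differentiable (R : realType) (V W : normedModType R)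
    (A : set V) (f : V -> W) (x : V) :
  smooth_on A f -> A x -> differentiable f x.
Proof. by move=> /(_ 1%N)[df _]; exact: df. Qed.

Lemma smooth_on_derive (R : realType) (V W : normedModType R)
    (A : set V) (f : V -> W) (v : V) :
  smooth_on A f -> smooth_on A ('D_v f).
Proof. by move=> sf k; have [_] := sf k.+1; apply. Qed.

(** The scalar case, which rests on the mean value theorem, is applied to each coordinate.
    Derivatives of coordinates are identified with coordinates of derivatives on [A], a
    neighbourhood of each of its points. *)
Lemma smooth_on_derive_comm (R : realType) (V : normedModType R) (n : nat)
    (A : set V) (f : V -> 'rV[R]_n) (x v w : V) :
  open A -> smooth_on A f -> A x ->
  'D_w ('D_v f) x = 'D_v ('D_w f) x.
Proof.
move=> oA sf Ax.
have nA y : A y -> \forall z \near y, A z by move=> Ay; exact: open_nbhs_nbhs.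
have derive_coord u (h : V -> 'rV[R]_n) k y : smooth_on A h -> A y ->
    'D_u (fun z => h z 0 k) y = ('D_u h y) 0 k.
  move=> sh Ay; rewrite derive_mx ?mxE //.
  by apply/diff_derivable/smooth_on_differentiable; [exact: sh|exact: Ay].
have diff_coord (h : V -> 'rV[R]_n) k y : smooth_on A h -> A y ->
    differentiable (fun z => h z 0 k) y.
  move=> sh Ay; have dh := smooth_on_differentiable sh Ay.
  exact: (differentiable_comp dh (differentiable_coord (h y) 0 k)).
have dd a k y : A y ->
    (\forall z \near y, ('D_a f z) 0 k = 'D_a (fun z => f z 0 k) z).
  move=> /nA; apply: filterS => z Az; exact/esym/derive_coord.
have ddd a b k y : A y -> (\forall z \near y, ('D_b ('D_a f) z) 0 k =
    'D_b ('D_a (fun z => f z 0 k)) z).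
  move=> /nA; apply: filterS => z Az; rewrite -derive_coord //.
    exact: near_eq_derive (dd _ _ _ Az).
  exact: smooth_on_derive.
apply/rowP => k.
have Evw := nbhs_singleton (ddd v w k x Ax).
have Ewv := nbhs_singleton (ddd w v k x Ax).
apply: etrans Evw (etrans _ (esym Ewv)).
apply: derive_comm.
- by apply: filterS (nA _ Ax) => z Az; exact: diff_coord.
- apply: filterS (nA _ Ax) => z Az.
  apply: near_eq_differentiable (dd v k z Az) _.
  by apply: diff_coord Az; exact: smooth_on_derive.
- apply: filterS (nA _ Ax) => z Az.
  apply: near_eq_differentiable (dd w k z Az) _.
  by apply: diff_coord Az; exact: smooth_on_derive.
- apply: differentiable_continuous.
  apply: near_eq_differentiable (ddd v w k x Ax) _.
  by apply: diff_coord Ax; do 2! apply: smooth_on_derive.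
- apply: differentiable_continuous.
  apply: near_eq_differentiable (ddd w v k x Ax) _.
  by apply: diff_coord Ax; do 2! apply: smooth_on_derive.
Qed.

(** Product rule for a linear form that varies with [s]: expanding the argument in the standard
    basis reduces it to products of real functions. *)
Lemma is_derive_linear_curve (R : realType) (n : nat)
    (L : R -> 'rV[R]_n -> R) (dL : 'rV[R]_n -> R) (a : R -> 'rV[R]_n)
    (a' : 'rV[R]_n) (t : R) :
  (forall s, scalar (L s)) ->
  (forall u, is_derive t 1 (fun s => L s u) (dL u)) ->
  is_derive t 1 a a' ->
  is_derive t 1 (fun s => L s (a s)) (dL (a t) + L t a').
Proof.
move=> linL dLP da.
have LE s u : L s u = \sum_k u 0 k * L s (delta_mx 0 k).
  pose f := GRing.isLinear.Build _ _ _ _ (L s) (linL s).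
  pose Ls : {linear 'rV[R]_n -> R^o} := HB.pack (L s) f.
  rewrite {1}(row_sum_delta u) -[L s]/(Ls : _ -> _) linear_sum.
  by apply: eq_bigr => k _; rewrite linearZ.
have dak k : is_derive t 1 (fun s => a s 0 k) (a' 0 k).
  have [dra <-] := da; apply: DeriveDef.
    exact: ((derivable_mxP a t 1).1 dra 0 k).
  by rewrite derive_mx // mxE.
have dsum (b : R -> 'rV[R]_n) (b' : 'rV[R]_n) :
    (forall k, is_derive t 1 (fun s => b s 0 k) (b' 0 k)) ->
    is_derive t 1 (fun s => L s (b s))
      (\sum_k (b t 0 k * dL (delta_mx 0 k) + L t (delta_mx 0 k) * b' 0 k)).
  move=> db; have -> : (fun s => L s (b s)) =
      \sum_k ((fun s => b s 0 k) * (fun s => L s (delta_mx 0 k))).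
    by apply/funext => s; rewrite LE fct_sumE.
  apply: is_derive_sum => k.
  exact: (is_deriveM (db k) (dLP (delta_mx 0 k))).
(* Along the constant curve [u] the derivative is [dL u], so [dsum] and the uniqueness of
   derivatives give the expansion of [dL] in the basis. *)
have dLE u : dL u = \sum_k u 0 k * dL (delta_mx 0 k).
  have du k : is_derive t 1 (fun=> u 0 k) ((0 : 'rV[R]_n) 0 k).
    by rewrite mxE; exact: is_derive_cst.
  have [_ <-] := dLP u; have [_ ->] := dsum (cst u) 0 du.
  by apply: eq_bigr => k _; rewrite mxE mulr0 addr0.
have := dsum a a' dak; rewrite big_split /= -dLE.
rewrite (_ : \sum_i _ = L t a') //.
by rewrite LE; apply: eq_bigr => k _; rewrite mulrC.
Qed.

(** * Charts and the local expression of an action *)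

Lemma chart_dom_nbhs (R : realType) (n : nat) (M : topologicalType)
    (c : chart R n M) (x : M) : chart_dom c x -> nbhs x (chart_dom c).
Proof.
by move=> cx; apply: open_nbhs_nbhs; split => //; exact: chart_dom_open.
Qed.

Lemma chart_cod_nbhs (R : realType) (n : nat) (M : topologicalType)
    (c : chart R n M) (z : 'rV[R]_n) : chart_cod c z -> nbhs z (chart_cod c).
Proof.
by move=> cz; apply: open_nbhs_nbhs; split => //; exact: chart_cod_open.
Qed.

Lemma chart_inv_continuous_at (R : realType) (n : nat) (M : topologicalType)
    (c : chart R n M) (z : 'rV[R]_n) :
  chart_cod c z -> {for z, continuous (chart_inv c)}.
Proof.
move=> cz; have := chart_inv_continuous (c := c).
rewrite continuous_open_subspace; last exact: chart_cod_open.
by apply; rewrite inE.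
Qed.

Lemma transition_differentiable (R : realType) (n : nat) (M : manifoldType R n)
    (c c' : chart R n M) (x : M) :
  atlas c -> atlas c' -> chart_dom c x -> chart_dom c' x ->
  differentiable (c' \o chart_inv c) (c x).
Proof.
move=> ac ac' cx c'x.
apply: (smooth_on_differentiable (atlas_smooth c c' ac ac')).
by split; [exact: chart_map_cod|rewrite /= chart_mapK].
Qed.

Lemma chart_mapK_diff (R : realType) (n : nat) (M : manifoldType R n)
    (c : chart R n M) (z : 'rV[R]_n) :
  chart_cod c z -> is_diff z (c \o chart_inv c) id.
Proof.
move=> cz; have did : is_diff z (@id 'rV[R]_n) id by exact: is_diff_id.
apply: near_eq_is_diff did.
by apply: filterS (chart_cod_nbhs cz) => y cy /=; rewrite chart_invK.
Qed.

(** Continuity keeps [f] inside the domain of [c] near [x], where [c' \o f] factors through the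
    transition map from [c] to [c']. *)
Lemma chart_change (R : realType) (n : nat) (M : manifoldType R n)
    (V : normedModType R) (f : V -> M) (c c' : chart R n M) (x : V) :
  atlas c -> atlas c' -> chart_dom c (f x) -> chart_dom c' (f x) ->
  {for x, continuous f} -> differentiable (c \o f) x ->
  is_diff x (c' \o f) ('d (c' \o chart_inv c) (c (f x)) \o 'd (c \o f) x).
Proof.
move=> ac ac' cx c'x cf df.
apply: (is_diff_comp_near (differentiableP df)
  (differentiableP (transition_differentiable ac ac' cx c'x))).
have nc : \forall z \near x, chart_dom c (f z).
  exact: cf _ (chart_dom_nbhs cx).
by apply: filterS nc => z cz /=; rewrite chart_mapK.
Qed.

(** The map F of the overview, with charts [c] at the source and [e] at the target. Taking a pair
    makes it the map that [smooth_map2] declares smooth, and turns partial derivatives into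
    directional ones along [(p, 0)] and [(0, v)]. *)
Definition local_action (R : realType) (m n : nat) (G : lieGroupType R m)
    (M : manifoldType R n) (act : G -> M -> M) (d : chart R m G)
    (c e : chart R n M) (q : 'rV[R]_m * 'rV[R]_n) : 'rV[R]_n :=
  e (act (chart_inv d q.1) (chart_inv c q.2)).

Definition local_action_dom (R : realType) (m n : nat) (G : lieGroupType R m)
    (M : manifoldType R n) (act : G -> M -> M) (d : chart R m G)
    (c e : chart R n M) : set ('rV[R]_m * 'rV[R]_n) :=
  [set q | [/\ chart_cod d q.1, chart_cod c q.2 &
               chart_dom e (act (chart_inv d q.1) (chart_inv c q.2))]].

(** Joint continuity of the action is combined with continuity of the inverse charts. Openness is
    what the symmetry of second derivatives asks for. *)
Lemma local_action_dom_open (R : realType) (m n : nat) (G : lieGroupType R m)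
    (M : manifoldType R n) (act : G -> M -> M) (d : chart R m G)
    (c e : chart R n M) :
  smooth_action act -> open (local_action_dom act d c e).
Proof.
move=> [_ _ [cact _]]; rewrite openE => -[q1 q2] [/= dq cq eq].
rewrite /interior; set q := (q1, q2).
have n1 : \forall p \near q, chart_cod d p.1.
  exact: (cvg_fst (chart_cod_nbhs dq)).
have n2 : \forall p \near q, chart_cod c p.2.
  exact: (cvg_snd (chart_cod_nbhs cq)).
have n3 : \forall p \near q,
    chart_dom e (act (chart_inv d p.1) (chart_inv c p.2)).
  have h1 : chart_inv d p.1 @[p --> q] --> chart_inv d q1.
    have h0 : p.1 @[p --> q] --> q1 by exact: cvg_fst.
    exact: (cvg_comp _ _ h0 (chart_inv_continuous_at dq)).
  have h2 : chart_inv c p.2 @[p --> q] --> chart_inv c q2.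
    have h0 : p.2 @[p --> q] --> q2 by exact: cvg_snd.
    exact: (cvg_comp _ _ h0 (chart_inv_continuous_at cq)).
  have h3 := cact (chart_inv d q1, chart_inv c q2).
  have h4 := cvg_comp2 h1 h2 h3.
  exact: h4 _ (chart_dom_nbhs eq).
by apply: filterS (filterI n1 (filterI n2 n3)) => p [? []].
Qed.

Lemma local_action_smooth (R : realType) (m n : nat) (G : lieGroupType R m)
    (M : manifoldType R n) (act : G -> M -> M) (d : chart R m G)
    (c e : chart R n M) :
  smooth_action act -> atlas d -> atlas c -> atlas e ->
  smooth_on (local_action_dom act d c e) (local_action act d c e).
Proof. by move=> [_ _ [_ sact]]; exact: sact. Qed.

(** * One-parameter subgroups, their orbits and the fields they generate *)

Lemma one_parameter_subgroup0 (R : realType) (m : nat) (G : lieGroupType R m)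
    (phi : R -> G) : one_parameter_subgroup phi -> phi 0 = 1%g.
Proof.
move=> [_ phiD]; apply: (@mulgI _ (phi 0)).
by rewrite -phiD addr0 mulg1.
Qed.

(** The vector p'(0), in the chart at the identity, where every one-parameter subgroup starts. *)
Definition generator (R : realType) (m : nat) (G : lieGroupType R m)
    (phi : R -> G) : 'rV[R]_m :=
  'd (chart_at (1%g : G) \o phi) 0 1.

Lemma generatorP (R : realType) (m : nat) (G : lieGroupType R m)
    (phi : R -> G) : one_parameter_subgroup phi ->
  is_diff 0 (chart_at (1%g : G) \o phi) (fun s => s *: generator phi).
Proof.
move=> ophi; have := ophi => -[[_ sphi] _].
have d0 : differentiable (chart_at (1%g : G) \o phi) 0.
  apply: (smooth_on_differentiable (sphi _ (chart_at_atlas _))).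
  by rewrite /= one_parameter_subgroup0 //; exact: chart_at_dom.
split => //; apply/funext => s; rewrite /generator.
by rewrite -[in LHS](mulr1 s) -[s * 1]/(s *: (1 : R^o)) linearZ.
Qed.

Lemma is_diff_is_derive (R : realType) (V W : normedModType R) (f df : V -> W)
    (x v : V) : is_diff x f df -> is_derive x v f (df v).
Proof.
move=> [dfx <-]; apply: DeriveDef; first exact: diff_derivable.
exact: deriveE.
Qed.

Lemma local_action_dom1 (R : realType) (m n : nat) (G : lieGroupType R m)
    (M : manifoldType R n) (act : G -> M -> M) (c : chart R n M)
    (z : 'rV[R]_n) :
  smooth_action act -> chart_cod c z ->
  let d := chart_at (1%g : G) in local_action_dom act d c c (d 1%g, z).
Proof.
move=> [act1 _ _] cz d; have d1 : chart_dom d 1%g := chart_at_dom _.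
split => //=; first exact: chart_map_cod.
by rewrite chart_mapK // act1; exact: chart_inv_dom.
Qed.

Lemma near_one_parameter_subgroup (R : realType) (m : nat)
    (G : lieGroupType R m) (phi : R -> G) :
  one_parameter_subgroup phi ->
  \forall t \near 0, chart_dom (chart_at (1%g : G)) (phi t).
Proof.
move=> ophi; have := ophi => -[[cphi _] _].
apply: (cphi 0); rewrite /= one_parameter_subgroup0 //.
exact: chart_dom_nbhs (chart_at_dom _).
Qed.

Lemma orbit_continuous (R : realType) (m n : nat) (G : lieGroupType R m)
    (M : manifoldType R n) (act : G -> M -> M) (phi : R -> G) (x : M) :
  smooth_action act -> one_parameter_subgroup phi ->
  continuous (fun t => act (phi t) x).
Proof.
move=> [_ _ [cact _]] [[cphi _] _] t.
have h := cact (phi t, x).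
have hx : (fun=> x) @ t --> x by exact: cvg_cst.
have h2 := cvg_comp2 (cphi t) hx h.
exact: h2.
Qed.

(** The curve [(d (phi t), z)] has velocity [(generator phi, 0)] at 0. The rule serves twice: [H] is
    the local action, which yields the field, or its derivative along [(0, u)], which yields a mixed
    second derivative. *)
Lemma is_derive_one_parameter_subgroup (R : realType) (m n : nat)
    (G : lieGroupType R m) (phi : R -> G) (W : normedModType R)
    (H : 'rV[R]_m * 'rV[R]_n -> W) (z : 'rV[R]_n) :
  one_parameter_subgroup phi ->
  let d := chart_at (1%g : G) in differentiable H (d 1%g, z) ->
  is_derive (0 : R) 1 (fun t => H (d (phi t), z))
    ('D_(generator phi, 0) H (d 1%g, z)).
Proof.
move=> ophi d dH; pose q t := (d (phi t), z).
have q0 : q 0 = (d 1%g, z) by rewrite /q one_parameter_subgroup0.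
have dq : is_diff 0 q (fun s => (s *: generator phi, 0)).
  exact: is_diff_pair (generatorP ophi) (is_diff_cst _ _).
rewrite -q0 in dH *.
have := is_diff_is_derive (1 : R) (is_diff_comp dq (differentiableP dH)).
by rewrite /= scale1r -(deriveE _ dH).
Qed.

(** For [t] near 0, [phi t] stays in the chart at the identity, and the orbit read in [c] is F(p(t),
    c x). *)
Lemma flow_is_derive (R : realType) (m n : nat) (G : lieGroupType R m)
    (M : manifoldType R n) (act : G -> M -> M) (phi : R -> G)
    (c : chart R n M) (x : M) :
  smooth_action act -> one_parameter_subgroup phi -> atlas c -> chart_dom c x ->
  let d := chart_at (1%g : G) in
  is_derive (0 : R) 1 (fun t => c (act (phi t) x))
    ('D_(generator phi, 0) (local_action act d c c) (d 1%g, c x)).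
Proof.
move=> sact ophi ac cx d.
have dF : differentiable (local_action act d c c) (d 1%g, c x).
  apply: (smooth_on_differentiable
    (local_action_smooth sact (chart_at_atlas _) ac ac)).
  by apply: local_action_dom1 => //; exact: chart_map_cod.
apply: near_eq_is_derive (is_derive_one_parameter_subgroup ophi dF).
apply: filterS (near_one_parameter_subgroup ophi) => t dt.
by rewrite /local_action /= !chart_mapK.
Qed.

(** The form in which elements of [killing_algebra] enter the computations in charts. *)
Definition generates_field (R : realType) (m n : nat) (G : lieGroupType R m)
    (M : manifoldType R n) (act : G -> M -> M) (phi : R -> G)
    (W : M -> 'rV[R]_n) : Prop :=
  one_parameter_subgroup phi /\
  forall x, W x = velocity (fun t => act (phi t) x) 0.

(** This is w(z), the derivative of F(p(t), z) at t = 0. With [y] the point of coordinates [z],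
    [velocity] differentiates in the chart at [y] and [field_in] applies the differential of the
    transition to [c]; by the chain rule the result is the derivative of the orbit read in [c]. *)
Lemma field_in_flow (R : realType) (m n : nat) (G : lieGroupType R m)
    (M : manifoldType R n) (act : G -> M -> M) (phi : R -> G)
    (W : M -> 'rV[R]_n) (c : chart R n M) (z : 'rV[R]_n) :
  smooth_action act -> generates_field act phi W -> atlas c -> chart_cod c z ->
  let d := chart_at (1%g : G) in
  field_in c W z = 'D_(generator phi, 0) (local_action act d c c) (d 1%g, z).
Proof.
move=> sact [ophi WE] ac cz d.
rewrite /field_in; set y := chart_inv c z.
have cy : chart_dom c y := chart_inv_dom cz.
have g0 : act (phi 0) y = y.
  by rewrite one_parameter_subgroup0 //; case: sact.
have [dy _] := flow_is_derive sact ophi (chart_at_atlas y) (chart_at_dom y).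
move/derivable1_diffP: dy => dy.
have gy : chart_dom (chart_at y) (act (phi 0) y).
  by rewrite g0; exact: chart_at_dom.
have gc : chart_dom c (act (phi 0) y) by rewrite g0.
have cg : continuous (fun t => act (phi t) y) by exact: orbit_continuous.
have dcy := chart_change (f := fun t : R => act (phi t) y) (chart_at_atlas y)
  ac gy gc (cg 0) dy.
have [_ E] := is_diff_is_derive (1 : R) dcy.
have [_ E'] := flow_is_derive sact ophi ac cy.
rewrite WE /velocity derive1E g0 (deriveE _ dy) -(chart_invK cz) -E'.
by move: E; rewrite /= g0 => <-.
Qed.

(** The formula of [field_in_flow] holds on the open set [chart_cod c], so it can be differentiated
    in z: Dw(z) v is a mixed second derivative of F. *)
Lemma is_diff_field_in_flow (R : realType) (m n : nat) (G : lieGroupType R m)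
    (M : manifoldType R n) (act : G -> M -> M) (phi : R -> G)
    (W : M -> 'rV[R]_n) (c : chart R n M) (z : 'rV[R]_n) :
  smooth_action act -> generates_field act phi W -> atlas c -> chart_cod c z ->
  let d := chart_at (1%g : G) in
  is_diff z (field_in c W) (fun v =>
    'D_(0, v) ('D_(generator phi, 0) (local_action act d c c)) (d 1%g, z)).
Proof.
move=> sact gW ac cz d.
set F := local_action act d c c; pose H := 'D_(generator phi, 0) F.
have dH : differentiable H (d 1%g, z).
  have sF := local_action_smooth sact (chart_at_atlas (1%g : G)) ac ac.
  apply: (smooth_on_differentiable (smooth_on_derive _ sF)).
  exact: local_action_dom1.
have dq : is_diff z (fun y => (d 1%g, y)) (fun v => (0, v)).
  by apply: is_diff_pair.
have nH : \forall y \near z, H (d 1%g, y) = field_in c W y.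
  apply: filterS (chart_cod_nbhs cz) => y cy.
  by rewrite (field_in_flow sact gW).
have [ddW E] := is_diff_comp_near dq (differentiableP dH) nH.
split; first exact: ddW.
by rewrite E; apply/funext => v; rewrite (deriveE _ dH).
Qed.

Lemma smooth_on_cst (R : realType) (V W : normedModType R) (A : set V)
    (a : W) : smooth_on A (cst a).
Proof.
move=> k; elim: k a => [|k IHk] a /=.
  by apply: continuous_subspaceT => x; exact: cvg_cst.
split=> [x _|v]; first exact: differentiable_cst.
rewrite [X in Ck_on _ _ X](_ : _ = cst 0); first exact: IHk.
by apply/funext => x; exact: derive_cst.
Qed.

Lemma lie_exp_one_parameter_subgroup (R : realType) (m : nat)
    (G : lieGroupType R m) (U : G -> 'rV[R]_m) :
  one_parameter_subgroup (lie_exp U).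
Proof.
(* The default value of [lie_exp] is the trivial one-parameter subgroup, so the
   existence of the exponential map is not needed. *)
rewrite /lie_exp; case: xgetP => [phi _ [] //|_].
split; last by move=> s t; rewrite mulg1.
split; first by move=> t; exact: cvg_cst.
by move=> c _; exact: smooth_on_cst.
Qed.

Lemma killing_algebraP (R : realType) (m n : nat) (G : lieGroupType R m)
    (M : manifoldType R n) (act : G -> M -> M) (W : M -> 'rV[R]_n) :
  killing_algebra act W -> exists phi, generates_field act phi W.
Proof.
move=> [U _ <-]; exists (lie_exp U); split => //.
exact: lie_exp_one_parameter_subgroup.
Qed.

(** * The metric along a flow *)

(** The metric in the coordinates of [c]. For fixed [u] and [v] it is the function of [z] whose
    smoothness is [metric_smooth]. *)
Definition metric_in (R : realType) (n : nat) (M : manifoldType R n)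
    (g : M -> 'rV[R]_n -> 'rV[R]_n -> R) (c : chart R n M)
    (z u v : 'rV[R]_n) : R :=
  let y := chart_inv c z in
  let toT := 'd (chart_at y \o chart_inv c) z in g y (toT u) (toT v).

Lemma metric_in_linear (R : realType) (n : nat) (M : manifoldType R n)
    (g : M -> 'rV[R]_n -> 'rV[R]_n -> R) (c : chart R n M) (z u : 'rV[R]_n) :
  riemannian_metric g -> scalar (metric_in g c z u).
Proof.
by move=> [lin _ _ _] a v w; rewrite /metric_in linearP; exact: lin.
Qed.

Lemma metric_in_sym (R : realType) (n : nat) (M : manifoldType R n)
    (g : M -> 'rV[R]_n -> 'rV[R]_n -> R) (c : chart R n M) (z u v : 'rV[R]_n) :
  riemannian_metric g -> metric_in g c z u v = metric_in g c z v u.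
Proof. by move=> [_ sym _ _]; exact: sym. Qed.

(** Passing from the chart at [y] to [c] and back is the identity near [chart_at y y], so by the
    chain rule the differentials of the two transition maps compose to the identity. *)
Lemma field_inK (R : realType) (n : nat) (M : manifoldType R n)
    (c : chart R n M) (z : 'rV[R]_n) (U : M -> 'rV[R]_n) :
  atlas c -> chart_cod c z ->
  let y := chart_inv c z in
  'd (chart_at y \o chart_inv c) z (field_in c U z) = U y.
Proof.
move=> ac cz y.
have yy : chart_dom (chart_at y) y := chart_at_dom y.
have cy : chart_dom c y := chart_inv_dom cz.
have codyy := chart_map_cod yy.
have invy : chart_inv (chart_at y) (chart_at y y) = y by exact: chart_mapK.
have [_ E] : is_diff (chart_at y y) (chart_at y \o chart_inv (chart_at y))
    ('d (chart_at y \o chart_inv c) z \o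
     'd (c \o chart_inv (chart_at y)) (chart_at y y)).
  (* The base point is rewritten so that [chart_change] applies to the map [chart_inv (chart_at y)]
     at [chart_at y y]. *)
  rewrite -[in X in 'd _ X \o _](chart_invK cz) -/y -[in X in c X]invy.
  apply: chart_change => //; try by rewrite invy.
  - exact: chart_at_atlas.
  - exact: chart_inv_continuous_at.
  - by apply: transition_differentiable => //; exact: chart_at_atlas.
have [_ E'] := chart_mapK_diff codyy.
exact: (congr1 (fun f => f (U y)) (etrans (esym E) E')).
Qed.

Lemma metric_in_field (R : realType) (n : nat) (M : manifoldType R n)
    (g : M -> 'rV[R]_n -> 'rV[R]_n -> R) (c : chart R n M) (z : 'rV[R]_n)
    (U V : M -> 'rV[R]_n) :
  atlas c -> chart_cod c z ->
  let y := chart_inv c z in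
  metric_in g c z (field_in c U z) (field_in c V z) = g y (U y) (V y).
Proof. by move=> ac cz y; rewrite /metric_in !field_inK. Qed.

(** [tangent_map] lands in the chart at [act a x], which varies with [a]. A change of chart replaces
    it by the fixed chart [c] at [x], so that a whole piece of an orbit is handled in one chart. *)
Lemma metric_in_isometry (R : realType) (m n : nat) (G : lieGroupType R m)
    (M : manifoldType R n) (g : M -> 'rV[R]_n -> 'rV[R]_n -> R)
    (act : G -> M -> M) (a : G) (x : M) (u v : 'rV[R]_n) :
  let c := chart_at x in
  by_isometries g act -> chart_dom c (act a x) ->
  {for c x, continuous (act a \o chart_inv c)} ->
  differentiable (c \o (act a \o chart_inv c)) (c x) ->
  let D := 'd (c \o (act a \o chart_inv c)) (c x) in
  metric_in g c (c (act a x)) (D u) (D v) = g x u v.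
Proof.
move=> c isom cax cont dif D.
have cx : chart_dom c x := chart_at_dom x.
have invx : chart_inv c (c x) = x by exact: chart_mapK.
have [_ E] : is_diff (c x) (chart_at (act a x) \o (act a \o chart_inv c))
    ('d (chart_at (act a x) \o chart_inv c) (c ((act a \o chart_inv c) (c x)))
     \o D).
  apply: chart_change => //; try exact: chart_at_atlas; rewrite /= invx //.
  exact: chart_at_dom.
rewrite /metric_in chart_mapK // -(isom a x u v) /tangent_map -/c.
move: E; rewrite /= invx => E.
have E2 w : 'd (chart_at (act a x) \o act a \o chart_inv c) (c x) w =
    'd (chart_at (act a x) \o chart_inv c) (c (act a x)) (D w).
  exact: (congr1 (fun f => f w) E).
exact: congr2 (esym (E2 u)) (esym (E2 v)).
Qed.

Lemma is_derive_comp_curve (R : realType) (V W : normedModType R)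
    (h : V -> W) (psi : R -> V) (t : R) (w : V) :
  differentiable h (psi t) -> is_derive t 1 psi w ->
  is_derive t 1 (h \o psi) ('D_w h (psi t)).
Proof.
move=> dh [/derivable1_diffP dpsi <-].
have := is_diff_is_derive (1 : R)
  (is_diff_comp (differentiableP dpsi) (differentiableP dh)).
by rewrite /= -(deriveE _ dpsi) -(deriveE _ dh).
Qed.

(** The metric is linear in each vector, so [is_derive_linear_curve] is applied once for [b] and
    once for [a]; what remains is the variation of the metric coefficients along [psi]. *)
Lemma is_derive_metric_curve (R : realType) (n : nat) (M : manifoldType R n)
    (g : M -> 'rV[R]_n -> 'rV[R]_n -> R) (c : chart R n M)
    (psi a b : R -> 'rV[R]_n) (w a' b' : 'rV[R]_n) (t : R) :
  riemannian_metric g -> atlas c -> chart_cod c (psi t) ->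
  is_derive t 1 psi w -> is_derive t 1 a a' -> is_derive t 1 b b' ->
  is_derive t 1 (fun s => metric_in g c (psi s) (a s) (b s))
    ('D_w (fun z => metric_in g c z (a t) (b t)) (psi t) +
     metric_in g c (psi t) a' (b t) + metric_in g c (psi t) (a t) b').
Proof.
move=> rg ac cpsi dpsi da db.
have dm u v : differentiable (fun z => metric_in g c z u v) (psi t).
  exact: (smooth_on_differentiable (metric_smooth rg u v ac)).
apply: (@is_derive_linear_curve _ _ (fun s => metric_in g c (psi s) (a s))
  (fun v => 'D_w (fun z => metric_in g c z (a t) v) (psi t) +
     metric_in g c (psi t) a' v)) => //.
  by move=> s; exact: metric_in_linear.
(* Symmetry of the metric moves the curve [a] to the last argument, where the same rule applies
   again. *)
move=> v; rewrite (metric_in_sym _ _ _ _ rg).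
have -> : (fun s => metric_in g c (psi s) (a s) v) =
    (fun s => metric_in g c (psi s) v (a s)).
  by apply/funext => s; exact: metric_in_sym.
apply: (@is_derive_linear_curve _ _ (fun s => metric_in g c (psi s) v)
  (fun u => 'D_w (fun z => metric_in g c z u v) (psi t))) => //.
  by move=> s; exact: metric_in_linear.
move=> u.
have -> : (fun s => metric_in g c (psi s) v u) =
    (fun z => metric_in g c z u v) \o psi.
  by apply/funext => s; exact: metric_in_sym.
exact: is_derive_comp_curve (dm u v) dpsi.
Qed.

Lemma field_in_at (R : realType) (n : nat) (M : manifoldType R n)
    (U : M -> 'rV[R]_n) (x : M) :
  field_in (chart_at x) U (chart_at x x) = U x.
Proof.
have cx := chart_at_dom x.
rewrite /field_in chart_mapK //.
by have [_ ->] := chart_mapK_diff (chart_map_cod cx).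
Qed.

(** Freezing the group coordinates at those of [a] turns F into the expression of [act a] in [c], so
    its differential is D_z F. *)
Lemma is_diff_local_action (R : realType) (m n : nat) (G : lieGroupType R m)
    (M : manifoldType R n) (act : G -> M -> M) (d : chart R m G)
    (c : chart R n M) (a : G) (x : M) :
  smooth_action act -> atlas d -> atlas c ->
  chart_dom d a -> chart_dom c x -> chart_dom c (act a x) ->
  is_diff (c x) (c \o (act a \o chart_inv c))
    (fun u => 'D_(0, u) (local_action act d c c) (d a, c x)).
Proof.
move=> sact ad ac da cx cax; set F := local_action act d c c.
have dF : differentiable F (d a, c x).
  apply: (smooth_on_differentiable (local_action_smooth sact ad ac ac)).
  by split => /=; rewrite ?chart_mapK //; exact: chart_map_cod.
have dq : is_diff (c x) (fun y => (d a, y)) (fun v => (0, v)).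
  by apply: is_diff_pair.
have -> : c \o (act a \o chart_inv c) = F \o (fun y => (d a, y)).
  by apply/funext => y; rewrite /F /local_action /= chart_mapK.
have [dFq E] := is_diff_comp dq (differentiableP dF).
split; first exact: dFq.
by rewrite E; apply/funext => v; rewrite (deriveE _ dF).
Qed.

Lemma action_continuous (R : realType) (m n : nat) (G : lieGroupType R m)
    (M : manifoldType R n) (act : G -> M -> M) (a : G) :
  smooth_action act -> continuous (act a).
Proof.
move=> [_ _ [cact _]] x.
have ha : (fun=> a) @ x --> a by exact: cvg_cst.
have h2 := cvg_comp2 ha (@cvg_id _ (nbhs x)) (cact (a, x)).
exact: h2.
Qed.

Lemma killing_differentiable (R : realType) (m n : nat) (G : lieGroupType R m)
    (M : manifoldType R n) (act : G -> M -> M) (U : M -> 'rV[R]_n)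
    (c : chart R n M) (z : 'rV[R]_n) :
  smooth_action act -> killing_algebra act U -> atlas c -> chart_cod c z ->
  differentiable (field_in c U) z.
Proof.
move=> sact /killing_algebraP[phi gU] ac cz.
by have [] := is_diff_field_in_flow sact gU ac cz.
Qed.

(** Two pairs of vectors are followed along the orbit of [x]: the images of [U x] and [V x] under
    the isometries, and the values of [U] and [V]. Both have constant scalar product, and the two
    derivatives at 0 share the term coming from the metric coefficients. Subtracting them leaves the
    derivatives of the vectors, which combine into brackets. *)
Lemma killing_leibniz (R : realType) (m n : nat) (G : lieGroupType R m)
    (M : manifoldType R n) (g : M -> 'rV[R]_n -> 'rV[R]_n -> R)
    (act : G -> M -> M) (W U V : M -> 'rV[R]_n) (r : R) (x : M) :
  riemannian_metric g -> smooth_action act -> by_isometries g act ->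
  killing_algebra act W -> killing_algebra act U -> killing_algebra act V ->
  (forall y, g y (U y) (V y) = r) ->
  g x (lie_bracket W U x) (V x) + g x (U x) (lie_bracket W V x) = 0.
Proof.
move=> rg sact isom /killing_algebraP[phi gW] kU kV gUV.
have [ophi _] := gW.
pose d := chart_at (1%g : G); pose c := chart_at x; pose z := c x.
have ad : atlas d := chart_at_atlas _.
have ac : atlas c := chart_at_atlas _.
have d1 : chart_dom d 1%g := chart_at_dom _.
have cx : chart_dom c x := chart_at_dom _.
have cz : chart_cod c z := chart_map_cod cx.
have invz : chart_inv c z = x by exact: chart_mapK.
have phi0 := one_parameter_subgroup0 ophi.
have act1x : act 1%g x = x by case: sact.
pose psi t := c (act (phi t) x).
have psi0 : psi 0 = z by rewrite /psi phi0 act1x.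
set F := local_action act d c c.
(* For small [t] this is the image of [u] under the differential of [act (phi t)] at [x], in the
   coordinates of [c]. *)
pose E u t := 'D_(0, u) F (d (phi t), z).
have nx : \forall t \near (0 : R), chart_dom c (act (phi t) x).
  have cg : continuous (fun t => act (phi t) x) by exact: orbit_continuous.
  apply: (cg 0); rewrite /= phi0 act1x; exact: chart_dom_nbhs.
have nd := near_one_parameter_subgroup ophi.
have dpsi : is_derive (0 : R) 1 psi (W x).
  have := field_in_flow sact gW ac cz; rewrite field_in_at => ->.
  exact: flow_is_derive.
have E0 u : E u 0 = u.
  have cax : chart_dom c (act 1%g x) by rewrite act1x.
  have := is_diff_local_action sact ad ac d1 cx cax.
  rewrite (_ : act 1%g \o chart_inv c = chart_inv c); last first.
    by apply/funext => y; case: sact => act1 _ _; exact: act1.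
  move=> [_ e1]; have [_ e2] := chart_mapK_diff cz.
  have e := congr1 (fun f => f u) (etrans (esym e1) e2).
  by rewrite /E phi0; exact: e.
(* Here F is differentiated along [(0, u)] and then along [(generator phi, 0)]; in the opposite
   order this is the differential of w applied to [u]. *)
have dE u : is_derive (0 : R) 1 (E u) ('D_u (field_in c W) z).
  have sF := local_action_smooth sact ad ac ac.
  have oF := @local_action_dom_open _ _ _ _ _ _ d c c sact.
  have F1 := local_action_dom1 sact cz.
  have dF := smooth_on_differentiable (smooth_on_derive (0, u) sF) F1.
  have := is_derive_one_parameter_subgroup ophi dF.
  rewrite (smooth_on_derive_comm _ _ oF sF F1).
  have [dW e] := is_diff_field_in_flow sact gW ac cz.
  by rewrite (deriveE _ dW) e.
have dfield (Y : M -> 'rV[R]_n) : killing_algebra act Y ->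
    is_derive (0 : R) 1 (field_in c Y \o psi) ('D_(W x) (field_in c Y) z).
  move=> kY; rewrite -psi0; apply: is_derive_comp_curve dpsi.
  by rewrite psi0; exact: killing_differentiable kY ac cz.
have field0 (Y : M -> 'rV[R]_n) : (field_in c Y \o psi) 0 = Y x.
  by rewrite /= psi0 field_in_at.
have cpsi : chart_cod c (psi 0) by rewrite psi0.
have dm1 := is_derive_metric_curve rg ac cpsi dpsi (dE (U x)) (dE (V x)).
have dm2 := is_derive_metric_curve rg ac cpsi dpsi (dfield _ kU) (dfield _ kV).
have n1 : \forall t \near (0 : R),
    g x (U x) (V x) = metric_in g c (psi t) (E (U x) t) (E (V x) t).
  apply: filterS (filterI nx nd) => t [cat dt].
  have [dat e] := is_diff_local_action sact ad ac dt cx cat.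
  rewrite /E -/z -(congr1 (fun f => f (U x)) e) -(congr1 (fun f => f (V x)) e).
  apply/esym/metric_in_isometry => //; rewrite -/c -/z.
  apply: (@continuous_comp _ _ _ (chart_inv c) (act (phi t))).
    exact: chart_inv_continuous_at.
  exact: action_continuous.
have n2 : \forall t \near (0 : R), r =
    metric_in g c (psi t) ((field_in c U \o psi) t) ((field_in c V \o psi) t).
  apply: filterS nx => t cat.
  by rewrite metric_in_field ?gUV //; exact: chart_map_cod.
have cst_derive (k l : R) (f : R -> R) : (\forall t \near (0 : R), k = f t) ->
    is_derive (0 : R) 1 f l -> l = 0.
  move=> kf [_ <-]; rewrite -(near_eq_derive _ kf); exact: derive_cst.
have e1 := cst_derive _ _ _ n1 dm1.
have e2 := cst_derive _ _ _ n2 dm2.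
rewrite !E0 psi0 in e1; rewrite !field0 psi0 in e2.
have mE u v : metric_in g c z u v = g x u v.
  rewrite /metric_in invz; have [_ e] := chart_mapK_diff cz.
  exact: congr2 (congr1 (fun f => f u) e) (congr1 (fun f => f v) e).
rewrite !mE in e1 e2.
have gBr a b v : g x v (a - b) = g x v a - g x v b.
  by rewrite -scaleN1r addrC (metric_linear rg) /= mulN1r addrC.
have gBl a b v : g x (a - b) v = g x a v - g x b v.
  have gs p q : g x p q = g x q p by exact: Defs.metric_sym.
  by rewrite !(gs _ v) gBr.
have dW : differentiable (field_in c W) z.
  by have [] := is_diff_field_in_flow sact gW ac cz.
have brE Y : killing_algebra act Y ->
    lie_bracket W Y x = 'D_(W x) (field_in c Y) z - 'D_(Y x) (field_in c W) z.
  move=> kY; have dY := killing_differentiable sact kY ac cz.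
  by rewrite (deriveE _ dW) (deriveE _ dY).
rewrite (brE _ kU) (brE _ kV) gBl gBr.
(* [D] is the common derivative of the metric coefficients along [W x]; [a1] and [b1] come from the
   transported vectors, [a2] and [b2] from the fields. *)
have sub_eqs (D a1 b1 a2 b2 : R) : D + a1 + b1 = 0 -> D + a2 + b2 = 0 ->
    a2 - a1 + (b2 - b1) = 0.
  rewrite -2!(addrA D) => h1 h2; rewrite addrACA -opprD; apply: (addrI D).
  by rewrite addrA h2 sub0r addr0; apply/esym/eqP; rewrite -addr_eq0 h1.
exact: sub_eqs e1 e2.
Qed.

(** * Brackets and ideals *)

Lemma lie_bracketC (R : realType) (n : nat) (M : manifoldType R n)
    (U V : M -> 'rV[R]_n) : lie_bracket U V = - lie_bracket V U.
Proof. by apply/funext => x; rewrite fctE /lie_bracket opprB. Qed.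

(** The term that differentiates the [U j] is additive because Killing fields are differentiable in
    charts. This allows [X] to be split along the direct sum. *)
Lemma lie_bracket_suml (R : realType) (m n : nat) (G : lieGroupType R m)
    (M : manifoldType R n) (act : G -> M -> M) (l : nat)
    (U : 'I_l -> M -> 'rV[R]_n) (V : M -> 'rV[R]_n) :
  smooth_action act -> (forall j, killing_algebra act (U j)) ->
  lie_bracket (\sum_j U j) V = \sum_j lie_bracket (U j) V.
Proof.
move=> sact kU; apply/funext => x; rewrite [in RHS]fct_sumE /lie_bracket /=.
set c := chart_at x; have ac : atlas c := chart_at_atlas _.
have cz := chart_map_cod (chart_at_dom x).
have dU j : differentiable (field_in c (U j)) (c x).
  exact: killing_differentiable (kU j) ac cz.
have -> : field_in c (\sum_j U j) = \sum_j field_in c (U j).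
  by apply/funext => z; rewrite /field_in !fct_sumE linear_sum.
have -> : (\sum_j U j) x = \sum_j U j x by rewrite fct_sumE.
have e1 (L : {linear 'rV[R]_n -> 'rV[R]_n}) :
    L (\sum_j U j x) = \sum_j L (U j x) by exact: linear_sum.
have dS : differentiable (\sum_j field_in c (U j)) (c x).
  exact: differentiable_sum.
have e2 : 'd (\sum_j field_in c (U j)) (c x) (V x) =
    \sum_j 'd (field_in c (U j)) (c x) (V x).
  apply: etrans (esym (deriveE _ dS)) (etrans (derive_sum _) _).
    by move=> j; exact: diff_derivable.
  by apply: eq_bigr => j _; exact: deriveE.
pose dV : {linear 'rV[R]_n -> 'rV[R]_n} := 'd (field_in c V) (c x).
rewrite (sumrB _ _ (fun j => dV (U j x))
  (fun j => 'd (field_in c (U j)) (c x) (V x))).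
exact: (congr2 (fun p q : 'rV[R]_n => p - q) (e1 dV) e2).
Qed.

(** For [U] in the set, [V] in [S] and [W] in [h], [killing_leibniz] applied to g(U, V) = 0 gives
    g([W, U], V) = - g(U, [W, V]), and [W, V] = 0. *)
Lemma perp_ideal (R : realType) (m n : nat) (G : lieGroupType R m)
    (M : manifoldType R n) (g : M -> 'rV[R]_n -> 'rV[R]_n -> R)
    (act : G -> M -> M) (h S : set (M -> 'rV[R]_n)) :
  riemannian_metric g -> smooth_action act -> by_isometries g act ->
  subspace_of h -> (forall U V, h U -> h V -> h (lie_bracket U V)) ->
  h `<=` killing_algebra act -> S `<=` killing_algebra act ->
  (forall U V, h U -> S V -> lie_bracket U V = 0) ->
  lie_ideal [set U | h U /\ forall V x, S V -> g x (U x) (V x) = 0] h.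
Proof.
move=> rg sact isom [h0 hD] hB hk Sk hS.
have gs x u v : g x u v = g x v u by exact: Defs.metric_sym.
have gD x a u v w : g x (a *: u + v) w = a * g x u w + g x v w.
  by rewrite (gs x _ w) (metric_linear rg) !(gs x w).
have g0 x w : g x 0 w = 0.
  by have := gD x (-1) 0 0 w; rewrite scaler0 addr0 mulN1r addNr.
split; last 2 first.
- by move=> U [].
- move=> W U hW [hU US]; split; first exact: hB.
  move=> V x SV; have kW := hk _ hW.
  have := killing_leibniz x rg sact isom kW (hk _ hU) (Sk _ SV) (US V ^~ SV).
  by rewrite (hS _ _ hW SV) (gs x _ 0) g0 addr0.
split; first by split => // V x _; exact: g0.
move=> a U V [hU US] [hV VS]; split; first exact: hD.
by move=> W x SW; rewrite gD US // VS // mulr0 addr0.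
Qed.

Theorem theorem2 (R : realType) (m n : nat)
    (G : lieGroupType R m) (M : manifoldType R n)
    (g : M -> 'rV[R]_n -> 'rV[R]_n -> R) (act : G -> M -> M)
    (X : M -> 'rV[R]_n) (l : nat) (h : 'I_l -> set (M -> 'rV[R]_n)) :
  connected [set: M] ->
  riemannian_metric g ->
  smooth_action act ->
  effective act ->
  by_isometries g act ->
  killing_algebra act X ->
  (exists r : R, forall x, g x (X x) (X x) = r) ->
  (2 <= l)%N ->
  direct_lie_sum (killing_algebra act) h ->
  exists u : 'I_l -> set (M -> 'rV[R]_n),
    [/\ forall i, lie_ideal (u i) (h i),
        forall i Y, h i Y -> u i (lie_bracket X Y) &
        forall i j, i != j -> forall U V, u i U -> u j V ->
          forall x, g x (U x) (V x) = 0].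
Proof.
move=> _ rg sact _ isom kX [r gXX] _ [hsub hB hC kE _].
have gs x u v : g x u v = g x v u by exact: Defs.metric_sym.
have g0 x u : g x u 0 = 0.
  have := metric_linear rg x u (-1) 0 0.
  by rewrite scaler0 addr0 /= mulN1r addNr.
have gN x u (V : M -> 'rV[R]_n) : g x u ((- V) x) = - g x u (V x).
  have := metric_linear rg x u (-1) (V x) 0.
  by rewrite g0 !addr0 /= mulN1r scaleN1r; exact.
have hk i U : h i U -> killing_algebra act U.
  move=> hU; rewrite kE; exists (fun j => if j == i then U else 0).
    by move=> j /=; case: eqP => [->|_] //; case: (hsub j).
  by rewrite -big_mkcond big_pred1_eq.
have h0 i : h i 0 by case: (hsub i).
have hN i U : h i U -> h i (- U).
  move=> hU; have [_ /(_ (-1) U 0 hU (h0 i))] := hsub i.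
  by rewrite addr0 scaleN1r.
(* Only the component of [X] in [h i] contributes to the bracket with [Y]. *)
have hXB i Y : h i Y -> h i (lie_bracket X Y).
  move=> hY; have := kX; rewrite kE => -[W hW <-].
  rewrite (lie_bracket_suml _ sact) => [|j]; last exact: hk (hW j).
  rewrite (bigD1 i) //= big1 ?addr0 => [|j ji]; first exact: hB.
  exact: hC ji (hW j) hY.
(* Differentiating g(X, X) along [Y] gives the same term twice. *)
have gXB i Y x : h i Y -> g x (X x) (lie_bracket X Y x) = 0.
  move=> hY; have kY := hk _ _ hY.
  have := killing_leibniz x rg sact isom kY kX kX gXX.
  rewrite (gs x _ (X x)) lie_bracketC gN -opprD => /eqP.
  by rewrite oppr_eq0 -mulr2n mulrn_eq0 /= => /eqP.
(* By [gXB], the function g(X, [X, Y]) is the constant 0, so it can be differentiated along [Z]. The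
   term with [Z, [X, Y]] vanishes because [X, Y] lies in [h i]. *)
have gXBB i j Y Z x : i != j -> h i Y -> h j Z ->
    g x (lie_bracket X Y x) (lie_bracket X Z x) = 0.
  move=> ij hY hZ; have kZ := hk _ _ hZ.
  have hXY := hXB _ _ hY.
  have := killing_leibniz x rg sact isom kZ kX (hk _ _ hXY) (gXB i Y ^~ hY).
  rewrite (hC j i Z _ _ hZ hXY) 1?eq_sym // (gs x _ (lie_bracket X Y x)).
  by rewrite g0 addr0 (lie_bracketC Z) gN => /eqP; rewrite oppr_eq0 => /eqP.
(* The ideal of [h i] generated by [X, [h i]], as an intersection; this form gives inclusion in any
   ideal containing these brackets. *)
pose u i := [set U | forall I, lie_ideal I (h i) ->
  (forall Y, h i Y -> I (lie_bracket X Y)) -> I U].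
have uI k : lie_ideal (u k) (h k).
  split.
  - split=> [I [[I0 _] _ _] _ //|a U V uU uV I idI IX].
    by have [[_ ID] _ _] := idI; apply: ID; [exact: uU|exact: uV].
  - move=> U /(_ (h k)); apply; last exact: hXB.
    by split; [exact: hsub|exact: subset_refl|exact: hB].
  - move=> U V hU uV I idI IX; have [_ _ IB] := idI.
    by apply: IB => //; exact: uV.
have uX k Y : h k Y -> u k (lie_bracket X Y) by move=> hY I _; exact.
exists u; split => // i j ij U V uU uV x.
have uh k : u k `<=` h k by case: (uI k).
have ideal_perp k k' S : k != k' -> S `<=` h k' ->
    lie_ideal [set A | h k A /\ forall B y, S B -> g y (A y) (B y) = 0] (h k).
  move=> kk' Sh; apply: perp_ideal rg sact isom (hsub k) (@hB k) (@hk k) _ _.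
    by move=> B /Sh; exact: hk.
  by move=> A B hA /Sh; exact: hC kk' hA.
(* First enlargement: the elements of [h i] orthogonal to [X, [h j]] form an ideal containing [X,
   [h i]] by [gXBB], hence containing [u i]. *)
have uP A Z y : u i A -> h j Z -> g y (A y) (lie_bracket X Z y) = 0.
  move=> uA hZ.
  have [|Y hY|_] := uA _ (ideal_perp _ _ [set lie_bracket X Z | Z in h j] ij _).
  - by move=> _ [B hB' <-]; exact: hXB.
  - by split=> [|_ z [B hB' <-]]; [exact: hXB|exact: gXBB ij hY hB'].
  - by apply; exists Z.
have ji : j != i by rewrite eq_sym.
(* Second enlargement: the elements of [h j] orthogonal to [u i] form an ideal containing [X, [h j]]
   by [uP], hence containing [u j]. *)
have [Y hY|_] := uV _ (ideal_perp _ _ (u i) ji (@uh i)).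
- by split=> [|A y uA]; [exact: hXB|rewrite gs; exact: uP].
- by move=> VS; rewrite gs; exact: VS.
Qed.
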